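(* Let $n\ge 2$ be an integer and $N_{\rm d}$ a positive integer. The fewest voters necessary to sway an election in an $n$-level hierarchical majority-voting system with $N_{\rm d}$ voters occurs when $k^{(i)}=N_{\rm d}^{1/n}$ for all $1\le i\le n$. That is, the function $$V(k^{(1)},\dots,k^{(n)})=\prod_{i=1}^{n}\frac{k^{(i)}+1}{2},$$ on the set of $n$-tuples of positive real numbers with $k^{(1)}k^{(2)}\cdots k^{(n)}=N_{\rm d}$, attains its minimum at $k^{(1)}=k^{(2)}=\dots=k^{(n)}=N_{\rm d}^{1/n}$.
   Context: In an $n$-level hierarchical majority-voting system, $k^{(i)}$ (odd) is the number of voters (for $i=1$) or of lower-level groups (for $i\ge 2$) in each group at level $i$, and the total number of voters is $N_{\rm d}=k^{(1)}\cdots k^{(n)}$. Each group adopts the majority decision of its members, and the single group at level $n$ determines the election outcome. The smallest number of voters whose support for an outcome can suffice for that outcome to win is $V(k^{(1)},\dots,k^{(n)})=\prod_{i=1}^n\frac{k^{(i)}+1}{2}$, since a bare majority of $(k^{(i)}+1)/2$ members is needed in each relevant group at each level. The function $V$ is considered for positive real arguments under the constraint $k^{(1)}\cdots k^{(n)}=N_{\rm d}$; when $N_{\rm d}^{1/n}$ is an odd integer the minimizer is itself an admissible voting system. *)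

(* Defs.v *)
(* MathComp-Analysis; the reals are an arbitrary realType. *)
From mathcomp Require Import all_boot all_order all_algebra.
From mathcomp Require Import all_classical all_reals all_analysis.

Set Implicit Arguments.
Unset Strict Implicit.
Unset Printing Implicit Defensive.

Import Order.TTheory GRing.Theory Num.Theory.
Local Open Scope classical_set_scope.
Local Open Scope ring_scope.

(* A tuple k : 'I_n -> R lists the group sizes of an n-level hierarchical
   majority-voting system, k i being the size at level i + 1; the sizes are
   relaxed from odd integers to positive reals. *)

(* A bare majority, (k i + 1) / 2 members, is needed in each relevant group of
   each level. *)
Definition V (R : realType) (n : nat) (k : 'I_n -> R) : R :=
  \prod_(i < n) ((k i + 1) / 2).

Definition voting_systems (R : realType) (n Nd : nat) : set ('I_n -> R) :=
  [set k | (forall i, 0 < k i) /\ \prod_(i < n) k i = Nd%:R].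
Arguments voting_systems : clear implicits.

Definition attains_min_at (R : realType) (T : Type) (A : set T) (f : T -> R)
    (x0 : T) : Prop :=
  A x0 /\ forall x, A x -> f x0 <= f x.

(* Main.v *)
(* With [v i = (k i + 1) / 2], the terms [k i / v i] and [1 / v i] add up to 2.
   AM-GM applied to each of the two families bounds their geometric means
   [t / p] and [1 / p], where [t ^+ n] is the product of the [k i] and
   [p ^+ n = V k], by arithmetic means of total 2;
   hence [(t + 1) / p <= 2]. *)
Require Import Defs.
From mathcomp Require Import all_boot all_order all_algebra.
From mathcomp Require Import all_classical all_reals all_analysis.

Set Implicit Arguments.
Unset Strict Implicit.
Unset Printing Implicit Defensive.

Import Order.TTheory GRing.Theory Num.Theory.
Local Open Scope classical_set_scope.
Local Open Scope ring_scope.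

Lemma AGM_ord (R : realFieldType) (n : nat) (E : 'I_n -> R) :
  (forall i, 0 <= E i) ->
  \prod_(i < n) E i <= ((\sum_(i < n) E i) / n%:R) ^+ n.
Proof.
move=> E_ge0; have := leif_AGM (A := 'I_n) (E := E) (fun i _ => E_ge0 i).
by move=> /leifP; rewrite card_ord; case: ifP => _ => [/eqP ->|/ltW].
Qed.

Lemma natroot_powR (R : realType) (n : nat) (x : R) :
  (0 < n)%N -> 0 <= x -> (x `^ n%:R^-1) ^+ n = x.
Proof.
move=> n_gt0 x_ge0; rewrite -powR_mulrn ?powR_ge0// -powRrM mulVf ?powRr1//.
by rewrite pnatr_eq0 -lt0n.
Qed.

(** Here [t] is the geometric mean of the [k i], so the left side is the value of [V] at the
    constant tuple [t]. *)
Lemma V_ge_geometric_mean (R : realType) (n : nat) (k : 'I_n -> R) (t : R) :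
  (0 < n)%N -> (forall i, 0 < k i) -> 0 <= t -> t ^+ n = \prod_(i < n) k i ->
  ((t + 1) / 2) ^+ n <= V k.
Proof.
move=> n_gt0 k_gt0 t_ge0 tnE.
pose v i := (k i + 1) / 2.
have v_gt0 i : 0 < v i by rewrite divr_gt0// addr_gt0.
have V_gt0 : 0 < V k by apply: prodr_gt0 => i _; exact: v_gt0.
pose p := V k `^ n%:R^-1.
have p_gt0 : 0 < p by exact: powR_gt0.
have pnE : p ^+ n = V k by apply: natroot_powR => //; exact: ltW.
(* Kept general in [u] to serve twice: for [u = k] with [x = t], and for the constant family 1 with
   [x = 1]. *)
have mean_bound (x : R) (u : 'I_n -> R) : 0 <= x -> (forall i, 0 <= u i) ->
    x ^+ n = \prod_(i < n) u i -> x / p <= (\sum_(i < n) u i / v i) / n%:R.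
  move=> x_ge0 u_ge0 xnE.
  have uv_ge0 i : 0 <= u i / v i by rewrite divr_ge0// ltW.
  (* Both sides are nonnegative, so their [n]-th powers may be compared; that of [x / p] is the
     product of the [u i / v i]. *)
  rewrite -(@ler_pXn2r _ n) ?nnegrE ?divr_ge0 ?sumr_ge0// ?(ltW p_gt0)//.
  by rewrite expr_div_n pnE xnE -prodf_div; exact: AGM_ord.
have t_le := mean_bound t k t_ge0 (fun i => ltW (k_gt0 i)) tnE.
have one_le : 1 / p <= (\sum_(i < n) 1 / v i) / n%:R.
  by apply: mean_bound => //; rewrite expr1n big1.
have sum2 : (\sum_(i < n) k i / v i) / n%:R + (\sum_(i < n) 1 / v i) / n%:R = 2.
  rewrite -mulrDl -big_split/=.
  have term i : k i / v i + 1 / v i = 2.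
    by rewrite -mulrDl /v invf_div mulrCA mulfV ?mulr1// gt_eqF// addr_gt0.
  rewrite (eq_bigr (fun=> 2)) => [|i _]; last exact: term.
  by rewrite sumr_const card_ord -(mulr_natr 2 n) mulfK// pnatr_eq0 -lt0n.
(* Since [V k = p ^+ n], it suffices that [(t + 1) / 2 <= p], that is [(t + 1) / p <= 2]: the sum of
   the two mean bounds. *)
rewrite -pnE lerXn2r ?nnegrE ?divr_ge0 ?addr_ge0// ?(ltW p_gt0)//.
by rewrite ler_pdivrMr// mulrC -ler_pdivrMr// mulrDl -sum2 lerD.
Qed.

Theorem theorem3 (R : realType) (n Nd : nat) (hn : (2 <= n)%N)
    (hNd : (0 < Nd)%N) :
  attains_min_at (voting_systems R n Nd) (@V R n)
    (fun _ : 'I_n => Nd%:R `^ (n%:R^-1)).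
Proof.
have n_gt0 : (0 < n)%N by exact: ltnW.
have rootE : (Nd%:R `^ n%:R^-1 : R) ^+ n = Nd%:R by exact: natroot_powR.
split.
  split=> [i|]; first by rewrite powR_gt0// ltr0n.
  by rewrite prodr_const card_ord.
(* Only the left [V] is unfolded: on a constant tuple it is an [n]-th power. *)
move=> k [k_gt0 kE]; rewrite {1}/V prodr_const card_ord.
by apply: V_ge_geometric_mean => //; rewrite ?powR_ge0// rootE kE.
Qed.
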